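(* Under the standing assumptions, suppose $R$ is a central $\beta$-Galois algebra (i.e. $R^\beta=C(R)$) and that $R$ satisfies the fundamental theorem. Then for every subalgebra $S$ of $R$ containing $R^\beta$ and separable over $R^\beta$, with $S'=V_R(S)$, one has $$V_R(S)=\bigoplus_{g\in H_S}J_g\qquad\text{and}\qquad S=\bigoplus_{g\in H_{S'}}J_g.$$
   Context: All rings and algebras are associative and unital. A groupoid is a nonempty set $\mathcal G$ with a partially defined associative multiplication in which every $g$ has an inverse $g^{-1}$, a left identity $r(g)=gg^{-1}$ and a right identity $d(g)=g^{-1}g$; $gh$ is defined iff $d(g)=r(h)$; $\mathcal G_0$ is the set of identities. A subgroupoid is a nonempty subset closed under inverses and defined products; it is wide if it contains $\mathcal G_0$. Standing assumptions: $K$ commutative ring, $R$ a $K$-algebra, $\mathcal G$ a finite groupoid, $\beta=(\{E_g\},\{\beta_g\})$ a unital action of $\mathcal G$ on $R$: $E_g=E_{r(g)}$ is an ideal of $R$, unital with identity $1_g$ (so $1_{g^{-1}}=1_{d(g)}$), $\beta_g:E_{g^{-1}}\to E_g$ a $K$-algebra isomorphism, $\beta_e=\mathrm{id}_{E_e}$ for $e\in\mathcal G_0$, $\beta_g\beta_h(x)=\beta_{gh}(x)$ whenever $d(g)=r(h)$, $x\in E_{h^{-1}}$; $R=\bigoplus_{e\in\mathcal G_0}E_e$; and $R$ is a $\beta$-Galois extension of $R^\beta$: there exist $x_i,y_i\in R$ ($1\le i\le m$) with $\sum_i x_i\beta_g(y_i1_{g^{-1}})=1_g$ if $g\in\mathcal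 G_0$ and $=0$ otherwise. For a subgroupoid $H$, $R^{\beta_H}=\{r\in R:\beta_h(r1_{h^{-1}})=r1_h\ \forall h\in H\}$, $R^\beta=R^{\beta_{\mathcal G}}$. $C(R)$ is the center of $R$, $V_R(S)=\{r\in R: rs=sr\ \forall s\in S\}$. For $g\in\mathcal G$, $J_g=\{r\in E_g: r\beta_g(x1_{g^{-1}})=xr\ \forall x\in R\}$. For a subring $T$ of $R$, $H_T=\{g\in\mathcal G:\beta_g(t1_{g^{-1}})=t1_g\ \forall t\in T\}$ (a wide subgroupoid). A ring extension $A\supseteq B$ is separable if there is $z=\sum_i a_i\otimes_B b_i\in A\otimes_B A$ with $\sum_i a_ib_i=1_A$ and $az=za$ for all $a\in A$. ''$R$ satisfies the fundamental theorem'' means: the Galois map $H\mapsto R^{\beta_H}$ on wide subgroupoids $H$ of $\mathcal G$ is injective, and every subalgebra $S$ of $R$ containing $R^\beta$ and separable over $R^\beta$ equals $R^{\beta_H}$ for some wide subgroupoid $H$. *)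

(* Defs.v *)
From HB Require Import structures.
From mathcomp Require Import all_boot all_order all_algebra.
From Stdlib Require Import ClassicalEpsilon.
Set Implicit Arguments. Unset Strict Implicit. Unset Printing Implicit Defensive.
Import GRing.Theory.
Local Open Scope ring_scope.

Definition pbool (P : Prop) : bool :=
  if excluded_middle_informative P then true else false.

(* mul is a total function, meaningful only on composable pairs (d g = r h). *)
Definition gr {G : finType} (mul : G -> G -> G) (inv : G -> G) (g : G) : G := mul g (inv g).
Definition gd {G : finType} (mul : G -> G -> G) (inv : G -> G) (g : G) : G := mul (inv g) g.

Record is_groupoid (G : finType) (mul : G -> G -> G) (inv : G -> G) : Prop := {
  gpd_nonempty : (0 < #|G|)%N;
  gpd_invK : forall g, inv (inv g) = g;
  gpd_d_r : forall g, gd mul inv (gr mul inv g) = gr mul inv g;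
  gpd_r_r : forall g, gr mul inv (gr mul inv g) = gr mul inv g;
  gpd_rmul : forall g, mul (gr mul inv g) g = g;
  gpd_muld : forall g, mul g (gd mul inv g) = g;
  gpd_d_mul : forall g h, gd mul inv g = gr mul inv h -> gd mul inv (mul g h) = gd mul inv h;
  gpd_r_mul : forall g h, gd mul inv g = gr mul inv h -> gr mul inv (mul g h) = gr mul inv g;
  gpd_assoc : forall g h k, gd mul inv g = gr mul inv h -> gd mul inv h = gr mul inv k ->
                mul (mul g h) k = mul g (mul h k)
}.

Definition gunits {G : finType} (mul : G -> G -> G) (inv : G -> G) : {set G} :=
  [set e | gd mul inv e == e].

Definition is_subgroupoid {G : finType} (mul : G -> G -> G) (inv : G -> G) (H : {set G}) : Prop :=
  [/\ H != set0,
      (forall g, g \in H -> inv g \in H) &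
      (forall g h, g \in H -> h \in H -> gd mul inv g = gr mul inv h -> mul g h \in H)].

Definition is_wide {G : finType} (mul : G -> G -> G) (inv : G -> G) (H : {set G}) : Prop :=
  is_subgroupoid mul inv H /\ gunits mul inv \subset H.

Definition is_ideal (R : pzRingType) (I : R -> Prop) : Prop :=
  [/\ I 0, (forall x y, I x -> I y -> I (x - y)) &
      (forall a x, I x -> I (a * x) /\ I (x * a))].

Definition is_direct_sum (G : finType) (M : zmodType) (H : {set G})
    (J : G -> M -> Prop) (V : M -> Prop) : Prop :=
  (forall v, V v <-> exists x : G -> M,
       (forall g, g \in H -> J g (x g)) /\ v = \sum_(g in H) x g) /\
  (forall x : G -> M, (forall g, g \in H -> J g (x g)) ->
       \sum_(g in H) x g = 0 -> forall g, g \in H -> x g = 0).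

Record is_unital_action (K : comPzRingType) (R : algType K) (G : finType)
    (mul : G -> G -> G) (inv : G -> G)
    (E : G -> R -> Prop) (one : G -> R) (beta : G -> R -> R) : Prop := {
  ua_ideal : forall g, is_ideal (E g);
  ua_E_r : forall g x, E g x <-> E (gr mul inv g) x;
  ua_one_mem : forall g, E g (one g);
  ua_one_l : forall g x, E g x -> one g * x = x;
  ua_one_r : forall g x, E g x -> x * one g = x;
  ua_beta_mem : forall g x, E (inv g) x -> E g (beta g x);
  ua_beta_add : forall g x y, E (inv g) x -> E (inv g) y ->
                  beta g (x + y) = beta g x + beta g y;
  ua_beta_mul : forall g x y, E (inv g) x -> E (inv g) y ->
                  beta g (x * y) = beta g x * beta g y;
  ua_beta_scale : forall g (k : K) x, E (inv g) x -> beta g (k *: x) = k *: beta g x;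
  ua_beta_one : forall g, beta g (one (inv g)) = one g;
  ua_beta_inj : forall g x y, E (inv g) x -> E (inv g) y -> beta g x = beta g y -> x = y;
  ua_beta_surj : forall g y, E g y -> exists2 x, E (inv g) x & beta g x = y;
  ua_beta_id : forall e x, e \in gunits mul inv -> E e x -> beta e x = x;
  ua_beta_comp : forall g h x, gd mul inv g = gr mul inv h -> E (inv h) x ->
                   beta g (beta h x) = beta (mul g h) x
}.

Section RingDefs.
Variables (K : comPzRingType) (R : algType K) (G : finType).
Variables (mul : G -> G -> G) (inv : G -> G) (E : G -> R -> Prop)
          (one : G -> R) (beta : G -> R -> R).

Definition is_galois_ext : Prop :=
  exists xy : seq (R * R), forall g : G,
    \sum_(p <- xy) p.1 * beta g (p.2 * one (inv g)) =
      (if g \in gunits mul inv then one g else 0).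

Definition fixring (H : {set G}) : R -> Prop :=
  fun x => forall h, h \in H -> beta h (x * one (inv h)) = x * one h.

Definition center_of : R -> Prop := fun x => forall y : R, x * y = y * x.

Definition centralizer (S : R -> Prop) : R -> Prop :=
  fun x => forall s, S s -> x * s = s * x.

Definition Jg (g : G) : R -> Prop :=
  fun r => E g r /\ forall x : R, r * beta g (x * one (inv g)) = x * r.

Definition HT (T : R -> Prop) : {set G} :=
  [set g | pbool (forall t, T t -> beta g (t * one (inv g)) = t * one g)].

End RingDefs.

Definition is_subalgebra (K : comPzRingType) (R : algType K) (S : R -> Prop) : Prop :=
  [/\ S 1, (forall x y, S x -> S y -> S (x - y)),
      (forall x y, S x -> S y -> S (x * y)) & (forall (k : K) x, S x -> S (k *: x))].

Definition balanced (R : pzRingType) (M : zmodType) (S B : R -> Prop) (f : R -> R -> M) : Prop :=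
  [/\ (forall x y z, S x -> S y -> S z -> f (x + y) z = f x z + f y z),
      (forall x y z, S x -> S y -> S z -> f x (y + z) = f x y + f x z) &
      (forall x y b, S x -> S y -> B b -> f (x * b) y = f x (b * y))].

(* S is separable over B: there is z = sum a_i (x)_B b_i in S (x)_B S with
   sum a_i b_i = 1 and a z = z a for all a in S.  Equality in S (x)_B S is
   expressed through its universal property (all B-balanced biadditive maps). *)
Definition is_separable_over (R : pzRingType) (S B : R -> Prop) : Prop :=
  exists z : seq (R * R),
    [/\ (forall p, p \in z -> S p.1 /\ S p.2),
        \sum_(p <- z) p.1 * p.2 = 1 &
        (forall a, S a -> forall (M : zmodType) (f : R -> R -> M), balanced S B f ->
           \sum_(p <- z) f (a * p.1) p.2 = \sum_(p <- z) f p.1 (p.2 * a))].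

Definition satisfies_FT (K : comPzRingType) (R : algType K) (G : finType)
    (mul : G -> G -> G) (inv : G -> G) (one : G -> R) (beta : G -> R -> R) : Prop :=
  (forall H1 H2 : {set G}, is_wide mul inv H1 -> is_wide mul inv H2 ->
     (forall x, fixring inv one beta H1 x <-> fixring inv one beta H2 x) -> H1 = H2) /\
  (forall S : R -> Prop, is_subalgebra S ->
     (forall x, fixring inv one beta [set: G] x -> S x) ->
     is_separable_over S (fixring inv one beta [set: G]) ->
     exists2 H : {set G}, is_wide mul inv H & forall x, S x <-> fixring inv one beta H x).

(* Main.v *)
(* Write [B g x] for [beta g (x * one (inv g))] and [fix H] for [fixring H].  The
   Galois system [xy] is a Casimir element over [fix H] for every wide [H], and
   [proj g u = \sum x * u * B g y] splits any [u] centralizing [fix H] as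
   [\sum_(g in H) proj g u] with [proj g u] in [J g]; hence the centralizer of
   [fix H] is the direct sum of the [J g], [g] in [H].

   When [fix G] is the center, [proj1 u = \sum x * u * y] is central and
   [proj1 (B g u) = proj1 u * one g].  Since traces attain [1], this inverts
   [\sum_(h in H) one h] and expresses every trace, then every [B g], through
   two-sided multiplications, so that [one g] lies in [J (inv g) * J g].  Picking
   [\sum a * b = one h] in [J (inv h) * J h], one gets that [fix H] is its own
   double centralizer, and that [(\sum_(h in H) one h)^-1 * \sum_(h in H) a (x) b]
   is a separability idempotent of the centralizer.  The fundamental theorem
   thus applies to both [S] and its centralizer. *)
Require Import Defs.
From HB Require Import structures.
From mathcomp Require Import all_boot all_order all_algebra.
From Stdlib Require Import ClassicalEpsilon FunctionalExtensionality PropExtensionality.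
Import GRing.Theory.
Local Open Scope ring_scope.

Lemma pboolP (P : Prop) : reflect P (pbool P).
Proof. by rewrite /pbool; case: excluded_middle_informative => h; constructor. Qed.

Lemma pred_ext (T : Type) (P Q : T -> Prop) : (forall x, P x <-> Q x) -> P = Q.
Proof.
by move=> PQ; apply: functional_extensionality => x; apply: propositional_extensionality.
Qed.

(** * Identities, inverses and cancellation in a finite groupoid *)

Section Groupoid.
Set Implicit Arguments.
Unset Strict Implicit.
Variables (G : finType) (mul : G -> G -> G) (inv : G -> G).
Hypothesis HG : is_groupoid mul inv.
Local Notation r := (gr mul inv).
Local Notation d := (gd mul inv).
Local Notation units := (gunits mul inv).

Lemma r_inv g : r (inv g) = d g.
Proof. by rewrite /gr /gd (gpd_invK HG). Qed.

Lemma d_inv g : d (inv g) = r g.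
Proof. by rewrite /gr /gd (gpd_invK HG). Qed.

Lemma r_r g : r (r g) = r g. Proof. exact: (gpd_r_r HG). Qed.
Lemma d_r g : d (r g) = r g. Proof. exact: (gpd_d_r HG). Qed.
Lemma r_d g : r (d g) = d g. Proof. by rewrite -[d g]r_inv r_r. Qed.
Lemma d_d g : d (d g) = d g. Proof. by rewrite -[d g]r_inv d_r. Qed.

Lemma unit_d g : d g \in units. Proof. by rewrite inE d_d. Qed.
Lemma unit_r g : r g \in units. Proof. by rewrite inE d_r. Qed.

Lemma d_unit e : e \in units -> d e = e. Proof. by rewrite inE => /eqP. Qed.
Lemma r_unit e : e \in units -> r e = e.
Proof. by move=> /d_unit <-; rewrite r_d. Qed.

Lemma d_mul g h : d g = r h -> d (mul g h) = d h. Proof. exact: (gpd_d_mul HG). Qed.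
Lemma r_mul g h : d g = r h -> r (mul g h) = r g. Proof. exact: (gpd_r_mul HG). Qed.
Lemma mul_rl g : mul (r g) g = g. Proof. exact: (gpd_rmul HG). Qed.
Lemma mul_dr g : mul g (d g) = g. Proof. exact: (gpd_muld HG). Qed.
Lemma gpd_mulA g h k : d g = r h -> d h = r k -> mul (mul g h) k = mul g (mul h k).
Proof. exact: (gpd_assoc HG). Qed.

Lemma gpd_mulKg g h : d g = r h -> mul (inv g) (mul g h) = h.
Proof.
by move=> dr; rewrite -gpd_mulA ?d_inv // -[mul _ g]/(d g) dr mul_rl.
Qed.

Lemma gpd_mulVKg g h : r g = r h -> mul g (mul (inv g) h) = h.
Proof.
by move=> dr; rewrite -gpd_mulA ?d_inv ?r_inv // -[mul g _]/(r g) dr mul_rl.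
Qed.

Lemma gpd_mulgK g h : d g = r h -> mul (mul g h) (inv h) = g.
Proof.
by move=> dr; rewrite gpd_mulA ?r_inv // -[mul h _]/(r h) -dr mul_dr.
Qed.

Lemma gpd_mulgVK g h : d g = d h -> mul (mul g (inv h)) h = g.
Proof.
by move=> dr; rewrite gpd_mulA ?r_inv ?d_inv // -[mul _ h]/(d h) -dr mul_dr.
Qed.

Lemma inv_unit e : e \in units -> inv e = e.
Proof.
move=> eu; have := mul_rl (inv e).
by rewrite r_inv d_unit // => <-; rewrite -/(gr mul inv e) r_unit.
Qed.

(** Converts the Galois condition, which tests for identities, into an orthogonality test between
    two elements with the same range. *)
Lemma mulV_unit g h : r g = r h -> (mul (inv g) h \in units) = (g == h).
Proof.
move=> gh; apply/idP/eqP => [/r_unit u|<-]; last exact: unit_d.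
rewrite -[LHS]mul_dr -(gpd_mulVKg gh); congr (mul g _).
by rewrite -u r_mul ?d_inv // r_inv.
Qed.

Lemma inv_mul g h : d g = r h -> inv (mul g h) = mul (inv h) (inv g).
Proof.
move=> dr; have h1 : d (inv h) = r (inv g) by rewrite d_inv r_inv.
have e : mul (mul g h) (mul (inv h) (inv g)) = r g.
  by rewrite -gpd_mulA ?(gpd_mulgK dr) // d_mul // r_inv.
have e2 : d (mul g h) = r (mul (inv h) (inv g)).
  by rewrite d_mul // (r_mul h1) r_inv.
by rewrite -(gpd_mulKg e2) e -(r_mul dr) -[r (mul g h)]d_inv mul_dr.
Qed.

Section Wide.
Variable H : {set G}.
Hypothesis HW : is_wide mul inv H.

Lemma wide_unit e : e \in units -> e \in H.
Proof. by case: HW => _ /subsetP; apply. Qed.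
Lemma wide_inv g : g \in H -> inv g \in H.
Proof. by case: HW => -[_ h _] _; apply: h. Qed.
Lemma wide_mul g h : g \in H -> h \in H -> d g = r h -> mul g h \in H.
Proof. by case: HW => -[_ _ ?] _; auto. Qed.
End Wide.

Lemma wide_setT : is_wide mul inv [set: G].
Proof.
split; last exact: subsetT.
split=> [||] *; rewrite ?inE //; rewrite -card_gt0 cardsT; exact: (gpd_nonempty HG).
Qed.

End Groupoid.

Section Galois.
Set Implicit Arguments.
Unset Strict Implicit.
Variables (K : comPzRingType) (R : algType K) (G : finType).
Variables (mul : G -> G -> G) (inv : G -> G) (E : G -> R -> Prop).
Variables (one : G -> R) (beta : G -> R -> R).
Hypothesis HG : is_groupoid mul inv.
Hypothesis Hact : is_unital_action mul inv E one beta.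
Hypothesis Hsum : is_direct_sum (gunits mul inv) E (fun _ => True).
Local Notation r := (gr mul inv).
Local Notation d := (gd mul inv).
Local Notation units := (gunits mul inv).
Local Notation fix_ := (fixring inv one beta).
Local Notation J := (Jg inv E one beta).

(** * The ideals [E g] and their orthogonal central idempotents *)

Lemma E0 g : E g 0. Proof. by case: (ua_ideal Hact g). Qed.
Lemma EB g x y : E g x -> E g y -> E g (x - y).
Proof. by case: (ua_ideal Hact g) => _ h _; apply: h. Qed.
Lemma ED g x y : E g x -> E g y -> E g (x + y).
Proof.
by move=> Ex Ey; rewrite -[y]opprK -[- y]add0r; apply/EB/EB/Ey/E0.
Qed.
Lemma EMl g a x : E g x -> E g (a * x).
Proof. by case: (ua_ideal Hact g) => _ _ h /h -/(_ a) []. Qed.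
Lemma EMr g a x : E g x -> E g (x * a).
Proof. by case: (ua_ideal Hact g) => _ _ h /h -/(_ a) []. Qed.

Lemma one1 g x : E g x -> one g * x = x. Proof. exact: (ua_one_l Hact). Qed.
Lemma one1r g x : E g x -> x * one g = x. Proof. exact: (ua_one_r Hact). Qed.
Lemma E_one g : E g (one g). Proof. exact: (ua_one_mem Hact). Qed.
Lemma E_Mone g x : E g (x * one g). Proof. exact: EMl (E_one g). Qed.
Lemma E_oneM g x : E g (one g * x). Proof. exact: EMr (E_one g). Qed.
Lemma one_comm g x : one g * x = x * one g.
Proof.
by rewrite -[LHS](one1r (EMr x (E_one g))) -mulrA one1 //; exact: E_Mone.
Qed.

Lemma E_eq g h x : r g = r h -> E g x -> E h x.
Proof. by move=> e /(proj1 (ua_E_r Hact _ _)); rewrite e => /(proj2 (ua_E_r Hact _ _)). Qed.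

Lemma one_eq g h : r g = r h -> one g = one h.
Proof.
move=> e; rewrite -(one1r (E_eq (esym e) (E_one h))) one_comm one1r //.
by apply: E_eq (E_one g).
Qed.

Lemma one_idem g : one g * one g = one g. Proof. exact/one1/E_one. Qed.

Lemma E_orth g h x : r g != r h -> E g x -> E h x -> x = 0.
Proof.
(* The family with [x] at [r g] and [- x] at [r h] sums to zero, so directness forces [x = 0]. *)
move=> gh Eg Eh; case: Hsum => _ /(_ (fun e => if e == r g then x else
  if e == r h then - x else 0)) H.
have := H _ _ (r g); rewrite eqxx; apply.
- move=> e _; case: eqP => [->|_]; first exact: E_eq (esym (r_r HG g)) Eg.
  case: eqP => [->|_]; last exact: E0.
  by rewrite -sub0r; apply: EB; [exact: E0 | exact: E_eq (esym (r_r HG h)) Eh].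
- rewrite (bigD1 (r g)) ?(unit_r HG) //= eqxx (bigD1 (r h)) ?(unit_r HG) //=; last first.
    by rewrite eq_sym.
  rewrite eq_sym (negPf gh) eqxx big1 ?addr0 ?subrr // => e /andP[/andP[_ /negPf ->]].
  by move=> /negPf ->.
- exact: (unit_r HG).
Qed.

Lemma one_orth g h : r g != r h -> one g * one h = 0.
Proof.
by move=> gh; apply: (E_orth gh); [apply: E_oneM | apply: E_Mone].
Qed.

Lemma sum_one : \sum_(e in units) one e = 1.
Proof.
case: Hsum => /(_ 1) [/(_ I) [x [Ex x1]] _] _.
(* Multiplying the decomposition of [1] by [one e] leaves only its component [x e]. *)
rewrite [RHS]x1; apply: eq_bigr => e eu; rewrite -[LHS]mulr1 x1 mulr_sumr.
rewrite (bigD1 e) //= (one1 (Ex _ eu)) big1 ?addr0 // => f /andP[fu fe].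
rewrite -(one1 (Ex _ fu)) mulrA one_orth ?mul0r //.
by rewrite !(r_unit HG) // eq_sym.
Qed.

(* Extension by zero of [beta g] to all of [R]: as [R] is the direct sum of
   the [E e], the partial action becomes one by non-unital endomorphisms. *)
Definition ebeta (g : G) (x : R) : R := beta g (x * one (inv g)).
Local Notation B := ebeta.

(** * Calculus of the extended maps [B g] *)

Lemma E_B g x : E g (B g x).
Proof. apply/(ua_beta_mem Hact)/E_Mone. Qed.

Lemma BD g x y : B g (x + y) = B g x + B g y.
Proof. by rewrite /ebeta mulrDl (ua_beta_add Hact) //; apply: E_Mone. Qed.

Lemma B0 g : B g 0 = 0.
Proof. by apply: (addrI (B g 0)); rewrite -BD !addr0. Qed.

Lemma beta0 g : beta g 0 = 0.
Proof. by have := B0 g; rewrite /ebeta mul0r. Qed.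

Lemma B_sum I (s : seq I) (P : pred I) F g :
  B g (\sum_(i <- s | P i) F i) = \sum_(i <- s | P i) B g (F i).
Proof. exact: (big_morph _ (BD g) (B0 g)). Qed.

Lemma BM g x y : B g (x * y) = B g x * B g y.
Proof.
rewrite /ebeta -(ua_beta_mul Hact) ?[_ * y]mulrA; try exact: E_Mone.
by rewrite -[x * _ * _]mulrA -mulrA one_comm -!mulrA one_idem.
Qed.

Lemma B_one1 g x : B g (x * one (inv g)) = B g x.
Proof. by rewrite /ebeta -mulrA one_idem. Qed.

Lemma B1 g : B g 1 = one g.
Proof. by rewrite /ebeta mul1r (ua_beta_one Hact). Qed.

Lemma one_d g : one (d g) = one (inv g).
Proof. by apply: one_eq; rewrite (r_d HG) (r_inv HG). Qed.
Lemma one_r g : one (r g) = one g.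
Proof. by apply: one_eq; rewrite (r_r HG). Qed.

Lemma oneB g x : one g * B g x = B g x. Proof. exact/one1/E_B. Qed.
Lemma Bone g x : B g x * one g = B g x. Proof. exact/one1r/E_B. Qed.

Lemma B_unit e x : e \in units -> B e x = x * one e.
Proof.
move=> eu; rewrite /ebeta (inv_unit HG eu) (ua_beta_id Hact) //.
exact: E_Mone.
Qed.

Lemma B_comp g h x : d g = r h -> B g (B h x) = B (mul g h) x.
Proof.
move=> gh; have e : one (inv g) = one h by rewrite -one_d gh one_r.
rewrite [LHS]/ebeta e Bone (ua_beta_comp Hact) //; last exact: E_Mone.
by rewrite /ebeta -!one_d (d_mul HG gh).
Qed.

Lemma B_comp0 g h x : d g != r h -> B g (B h x) = 0.
Proof.
move=> gh; rewrite {1}/ebeta -oneB -mulrA -one_comm mulrA -one_d one_orth.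
  by rewrite mul0r beta0.
by rewrite (r_d HG) eq_sym.
Qed.

Lemma B_oneE g e : e \in units -> B g (one e) = if d g == e then one g else 0.
Proof.
move=> eu; rewrite /ebeta -one_d; case: eqP => [<-|/eqP ge].
  by rewrite one_idem one_d (ua_beta_one Hact).
rewrite one_orth ?(r_d HG) ?(r_unit HG) 1?eq_sym //.
exact: beta0.
Qed.

Lemma sum_B_unit x : \sum_(e in units) B e x = x.
Proof.
under eq_bigr => e eu do rewrite B_unit //.
by rewrite -mulr_sumr sum_one mulr1.
Qed.

(** * Fixed elements and products of the [J g] *)

Lemma fixringM (H : {set G}) c u g : fix_ H c -> g \in H -> B g (c * u) = c * B g u.
Proof. by move=> cH gH; rewrite BM (cH g gH : B g c = _) -mulrA oneB. Qed.

Lemma fixringMr (H : {set G}) c u g : fix_ H c -> g \in H -> B g (u * c) = B g u * c.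
Proof.
by move=> cH gH; rewrite BM (cH g gH : B g c = _) -one_comm mulrA Bone.
Qed.

(** The indices multiply in reverse order: [y] turns [B h (B g u)] on its right into [B g u] on its
    left, and [x] then turns that into [u]. *)
Lemma Jg_mul g h x y : d h = r g -> J g x -> J h y -> J (mul h g) (x * y).
Proof.
move=> hg [Ex Jx] [Ey Jy]; split.
  by apply: E_eq (EMl x Ey); rewrite (r_mul HG).
move=> u; rewrite -/(B _ u) -(B_comp _ hg) -mulrA.
by rewrite (Jy : forall x, y * B h x = x * y) mulrA (Jx u : x * B g u = _) mulrA.
Qed.

(** Insert [one g] between [x] and [y]: moving it past [y] produces [B h (one g)], which
    vanishes. *)
Lemma Jg_mul0 g h x y : d h != r g -> J g x -> J h y -> x * y = 0.
Proof.
move=> hg [Ex Jx] [Ey Jy]; have := B_comp0 1 hg; rewrite B1 => B0'.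
by rewrite -(one1r Ex) -mulrA -(Jy (one g) : y * B h (one g) = _) B0' !mulr0.
Qed.

Lemma JgB g x u : J g x -> x * B g u = u * x. Proof. by case=> _ /(_ u). Qed.

(** The relation defining [J g], taken at [one (d g)], whose image under [B g] is [one g]. *)
Lemma Jg_oneV g x : J g x -> one (inv g) * x = x.
Proof.
move=> Jx; rewrite -(JgB _ Jx) -one_d B_oneE ?(unit_d HG) // eqxx.
by case: Jx => Ex _; rewrite one1r.
Qed.

Lemma Jg_unit e x u : e \in units -> J e x -> x * u = u * x.
Proof.
by move=> eu Jx; rewrite -(JgB u Jx) B_unit // -one_comm mulrA; case: Jx => Ex _; rewrite one1r.
Qed.

Lemma Jg_fixring g (H : {set G}) x s : g \in H -> J g x -> fix_ H s -> x * s = s * x.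
Proof.
move=> gH Jx sH; rewrite -(JgB s Jx) (sH g gH : B g s = _) -one_comm mulrA.
by case: Jx => Ex _; rewrite one1r.
Qed.

(** * Galois systems, traces and dual bases *)

Variable xy : seq (R * R).
Hypothesis Hxy : forall g, \sum_(p <- xy) p.1 * B g p.2 =
  if g \in units then one g else 0.

(** When the ranges agree, [B g] factors as [B h] after [B (mul (inv h) g)], so the sum is [B h] of
    the Galois sum at [mul (inv h) g]. *)
Lemma casimirB g h :
  \sum_(p <- xy) B h p.1 * B g p.2 = if h == g then one g else 0.
Proof.
case: (eqVneq (r h) (r g)) => [hg|hg]; last first.
  have /negPf-> : h != g by apply: contra_neq hg => ->.
  apply: big1 => p _; rewrite -Bone -[B g _]oneB mulrA -[_ * _ * one g]mulrA.
  by rewrite one_orth // mulr0 mul0r.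
have dr : d h = r (mul (inv h) g) by rewrite (r_mul HG) ?(r_inv HG) ?(d_inv HG).
transitivity (\sum_(p <- xy) B h (p.1 * B (mul (inv h) g) p.2)).
  by apply: eq_bigr => p _; rewrite BM B_comp // (gpd_mulVKg HG).
rewrite -B_sum Hxy (mulV_unit HG hg); case: eqP => [<-|_]; last by rewrite B0.
by rewrite B_oneE ?(unit_d HG) // eqxx.
Qed.

Definition trace (H : {set G}) (u : R) : R := \sum_(h in H) B h u.
Definition proj (g : G) (u : R) : R := \sum_(p <- xy) p.1 * u * B g p.2.
Definition proj1 (u : R) : R := \sum_(p <- xy) p.1 * u * p.2.

Section Wide.
Variable H : {set G}.
Hypothesis HW : is_wide mul inv H.

Lemma sum_translate (M : zmodType) g (F : G -> M) : g \in H ->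
  \sum_(h in H | r h == r g) F h = \sum_(k in H | r k == d g) F (mul g k).
Proof.
move=> gH; rewrite (reindex_onto (mul g) (mul (inv g))) /=; last first.
  by move=> h /andP[_ /eqP hg]; rewrite (gpd_mulVKg HG).
apply: eq_bigl => k; apply/andP/andP => [[/andP[hH /eqP hg] /eqP e]|[kH /eqP kg]].
  have gk : d (inv g) = r (mul g k) by rewrite (d_inv HG).
  by rewrite -e (wide_mul HW) ?(wide_inv HW) // (r_mul HG gk) (r_inv HG).
by rewrite (wide_mul HW) // (r_mul HG) // eqxx (gpd_mulKg HG).
Qed.

Lemma trace_fixring u : fix_ H (trace H u).
Proof.
move=> g gH; rewrite -/(B g _) B_sum mulr_suml.
rewrite (bigID (fun h => r h == d g)) /= [X in _ + X]big1 ?addr0; last first.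
  by move=> h /andP[_ hg]; rewrite B_comp0 // eq_sym.
rewrite [RHS](bigID (fun h => r h == r g)) /= [X in _ + X]big1 ?addr0; last first.
  by move=> h /andP[_ hg]; rewrite -Bone -mulrA one_orth // mulr0.
rewrite sum_translate //; apply: eq_bigr => h /andP[hH /eqP hg].
by rewrite B_comp // (one_eq (h := mul g h)) ?Bone // (r_mul HG).
Qed.

(** The two halves of [xy] are dual bases for the trace form: after exchanging sums, the Galois
    condition keeps only the identities, and these add up to [u]. *)
Lemma trace_dualr u : \sum_(p <- xy) p.1 * trace H (p.2 * u) = u.
Proof.
under eq_bigr => p _ do rewrite /trace mulr_sumr.
rewrite exchange_big /= -[RHS]sum_B_unit [RHS]big_mkcond [LHS]big_mkcond /=.
apply: eq_bigr => h _.
transitivity (if h \in H then (if h \in units then one h else 0) * B h u else 0).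
  case: ifP => // _; rewrite -Hxy mulr_suml.
  by apply: eq_bigr => p _; rewrite BM mulrA.
case: (boolP (h \in units)) => [hu|_]; last by rewrite mul0r if_same.
by rewrite (wide_unit HW) // oneB.
Qed.

Lemma trace_dual u : \sum_(p <- xy) trace H (u * p.1) * p.2 = u.
Proof.
under eq_bigr => p _ do rewrite /trace mulr_suml.
rewrite exchange_big /= -[RHS]sum_B_unit [RHS]big_mkcond [LHS]big_mkcond /=.
(* Splitting [p.2] as the sum of [B e p.2] over the identities makes [casimirB] applicable. *)
apply: eq_bigr => h _; transitivity (if h \in H then B h u *
    \sum_(e in units) \sum_(p <- xy) B h p.1 * B e p.2 else 0).
  case: ifP => // _; rewrite exchange_big mulr_sumr; apply: eq_bigr => p _ /=.
  by rewrite -mulr_sumr sum_B_unit BM mulrA.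
under eq_bigr => e _ do rewrite casimirB eq_sym.
rewrite -big_mkcondr /=; case: (boolP (h \in units)) => hu.
  rewrite (wide_unit HW) // (big_pred1 h) ?Bone // => e.
  by rewrite andbC /=; case: eqP => // ->.
by rewrite big_pred0 ?mulr0 ?if_same // => e; apply/andP => -[eu /eqP eh]; rewrite -eh eu in hu.
Qed.

Lemma trace_Mr u c : fix_ H c -> trace H (u * c) = trace H u * c.
Proof.
by move=> cH; rewrite mulr_suml; apply: eq_bigr => h hH; rewrite (fixringMr _ cH).
Qed.

(* [xy] is a Casimir element over [fix_ H]; the equality in the tensor square
   is tested against an arbitrary balanced map [x (x) y |-> F x y]. *)
Lemma casimir_comm (F : R -> R -> R) u :
  (forall x, {morph F x : y z / y + z}) ->
  (forall y, {morph F^~ y : x z / x + z}) ->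
  (forall x y b, fix_ H b -> F (x * b) y = F x (b * y)) ->
  \sum_(p <- xy) F p.1 (p.2 * u) = \sum_(p <- xy) F (u * p.1) p.2.
Proof.
move=> Fr Fl Fb.
have F0r x : F x 0 = 0 by apply: (addrI (F x 0)); rewrite -Fr !addr0.
have F0l x : F 0 x = 0 by apply: (addrI (F 0 x)); rewrite -Fl !addr0.
transitivity (\sum_(p <- xy) \sum_(q <- xy) F (p.1 * trace H (p.2 * (u * q.1))) q.2).
  apply: eq_bigr => p _; rewrite -{1}[p.2 * u]trace_dual.
  rewrite (big_morph _ (Fr p.1) (F0r p.1)); apply: eq_bigr => q _.
  by rewrite mulrA Fb //; apply: trace_fixring.
rewrite exchange_big; apply: eq_bigr => q _.
by rewrite -[in RHS](trace_dualr (u * q.1)) (big_morph _ (Fl _) (F0l _)).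
Qed.

(** * Decomposition of the centralizer of a fixed ring *)

Lemma proj_Jg g u : g \in H -> centralizer (fix_ H) u -> J g (proj g u).
Proof.
move=> gH uH; split.
  by apply: big_ind => [||p _]; [exact: E0 | exact: ED | exact/EMl/E_B].
move=> x; rewrite -/(B g x) mulr_suml mulr_sumr.
(* This map is balanced over [fix_ H] because [u] commutes with fixed elements and [B g] lets them
   out. *)
have := casimir_comm (F := fun y z => y * u * B g z) x.
under eq_bigr => p _ do rewrite BM mulrA.
move=> ->.
- by apply: eq_bigr => p _; rewrite !mulrA.
- by move=> y z t; rewrite BD mulrDr.
- by move=> y z t; rewrite !mulrDl.
- by move=> y z b bH; rewrite (fixringM _ bH) // mulrA -[_ * b * u]mulrA -uH // mulrA.
Qed.

Lemma sum_proj u : centralizer (fix_ H) u -> \sum_(g in H) proj g u = u.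
Proof.
move=> uH; rewrite exchange_big /=.
under eq_bigr => p _.
  (* The trace of [p.2] is fixed, so it commutes with [u], which leaves the dual basis expansion of
     [1]. *)
  rewrite -mulr_sumr -/(trace H p.2) -mulrA uH; last exact: trace_fixring.
  rewrite -[p.2]mulr1 mulrA.
  over.
by rewrite -mulr_suml trace_dualr mul1r.
Qed.

End Wide.

(** Moving [u] to the left turns [p.1] into [B h p.1], and [casimirB] evaluates the rest. *)
Lemma proj_id g h u : J h u -> proj g u = if h == g then u else 0.
Proof.
move=> Ju; rewrite /proj; under eq_bigr => p _ do rewrite -(JgB _ Ju) -mulrA.
rewrite -mulr_sumr casimirB; case: eqP => [<-|_]; last by rewrite mulr0.
by case: Ju => Eu _; rewrite one1r.
Qed.

Lemma projD g : {morph proj g : x y / x + y}.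
Proof.
by move=> x y; rewrite -big_split; apply: eq_bigr => p _; rewrite mulrDr mulrDl.
Qed.

Lemma proj0 g : proj g 0 = 0.
Proof. by rewrite /proj big1 // => p _; rewrite mulr0 mul0r. Qed.

Lemma centralizer_fixring H : is_wide mul inv H ->
  is_direct_sum H J (centralizer (fix_ H)).
Proof.
move=> HW; split=> [u|x Jx x0 g gH].
  split=> [uH|[x [Jx ->]] s sH].
    exists (proj^~ u); split=> [g gH|]; last by rewrite sum_proj.
    exact: proj_Jg gH uH.
  by rewrite mulr_suml mulr_sumr; apply: eq_bigr => g gH; apply: Jg_fixring gH (Jx g gH) sH.
(* [proj g] extracts the component [x g] from the vanishing sum. *)
rewrite -(proj0 g) -x0 (big_morph _ (projD g) (proj0 g)) (bigD1 g) //=.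
rewrite (proj_id _ (Jx g gH)) eqxx big1 ?addr0 // => h /andP[hH hg].
by rewrite (proj_id _ (Jx h hH)) (negPf hg).
Qed.

(** * The central case and the projection [proj1] *)

Hypothesis Hcentral : forall x, fix_ [set: G] x <-> center_of x.
Local Notation C := (fix_ [set: G]).
Local Notation WT := (wide_setT HG).

Lemma C_comm c u : C c -> c * u = u * c.
Proof. by move=> /Hcentral. Qed.

Lemma centralizer_C u : centralizer C u.
Proof. by move=> c cC; rewrite (C_comm _ cC). Qed.

Lemma Jg_C e x : e \in units -> J e x -> C x.
Proof. by move=> eu Jx; apply/Hcentral => u; apply: Jg_unit eu Jx. Qed.

Lemma C_one g : C (one g).
Proof. by apply/Hcentral => u; apply: one_comm. Qed.

Lemma C_trace u : C (trace [set: G] u).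
Proof. exact: trace_fixring WT u. Qed.

Lemma proj1D : {morph proj1 : x y / x + y}.
Proof.
by move=> x y; rewrite -big_split; apply: eq_bigr => p _; rewrite mulrDr mulrDl.
Qed.

Lemma proj1_0 : proj1 0 = 0.
Proof. by rewrite /proj1 big1 // => p _; rewrite mulr0 mul0r. Qed.

Lemma proj1_sum I (s : seq I) (P : pred I) F :
  proj1 (\sum_(i <- s | P i) F i) = \sum_(i <- s | P i) proj1 (F i).
Proof. exact: (big_morph _ proj1D proj1_0). Qed.

Lemma proj1_Mc u c : C c -> proj1 (u * c) = proj1 u * c.
Proof.
move=> cC; rewrite mulr_suml; apply: eq_bigr => p _.
by rewrite -!mulrA (C_comm _ cC).
Qed.

Lemma proj1_cM u c : C c -> proj1 (c * u) = c * proj1 u.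
Proof. by move=> cC; rewrite !(C_comm _ cC) proj1_Mc. Qed.

Lemma proj1E u : proj1 u = \sum_(e in units) proj e u.
Proof.
rewrite exchange_big; apply: eq_bigr => p _ /=.
by rewrite -mulr_sumr sum_B_unit.
Qed.

(** [proj1] is the projection onto the components at identities. *)
Lemma proj1_id g u : J g u -> proj1 u = if g \in units then u else 0.
Proof.
move=> Ju; rewrite proj1E.
under eq_bigr => e _ do rewrite (proj_id _ Ju) eq_sym.
rewrite -big_mkcondr /=; case: (boolP (g \in units)) => gu.
  rewrite (big_pred1 g) // => e.
  by rewrite andbC /=; case: eqP => // ->.
by rewrite big_pred0 // => e; apply/andP => -[eu /eqP eg]; rewrite -eg eu in gu.
Qed.

Lemma C_proj1 u : C (proj1 u).
Proof.
apply/Hcentral => x; rewrite mulr_suml mulr_sumr.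
have := casimir_comm WT (F := fun y z => y * u * z) x.
under eq_bigr => p _ do rewrite mulrA.
move=> ->.
- by apply: eq_bigr => p _; rewrite !mulrA.
- by move=> y z t; rewrite mulrDr.
- by move=> y z t; rewrite !mulrDl.
- by move=> y z b bC; rewrite -!mulrA; congr (y * _); rewrite !mulrA (C_comm u bC).
Qed.

Lemma proj1_1 : proj1 1 = 1.
Proof.
rewrite proj1E -[RHS]sum_one; apply: eq_bigr => e eu.
have := Hxy e; rewrite eu => <-.
by apply: eq_bigr => p _; rewrite mulr1.
Qed.

(** The image of [xy] under [B g] is still a dual system, relative to [one g]: by [casimirB], only
    [k = r g] contributes to the trace. *)
Lemma casimirB_trace g u :
  \sum_(p <- xy) B g p.1 * trace [set: G] (B g p.2 * u) = one g * u.
Proof.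
under eq_bigr => p _ do rewrite mulr_sumr.
rewrite exchange_big /= (bigD1 (r g)) ?inE //=.
rewrite [X in _ + X]big1 ?addr0 => [|k /andP[_ kg]].
  under eq_bigr => p _ do rewrite BM (B_comp _ (d_r HG g)) (mul_rl HG) mulrA.
  rewrite -mulr_suml casimirB eqxx B_unit ?(unit_r HG) // one_r.
  by rewrite mulrA -one_comm mulrA one_idem.
case: (eqVneq (d k) (r g)) => dk; last first.
  by apply: big1 => p _; rewrite BM B_comp0 // mul0r mulr0.
under eq_bigr => p _ do rewrite BM (B_comp _ dk) mulrA.
rewrite -mulr_suml casimirB; case: eqP => [e|_]; last by rewrite mul0r.
by move: kg; rewrite -(gpd_mulgK HG dk) -e eqxx.
Qed.

(** Expand [B g p.2] in the dual system; the traces that appear are central, so they pass [u] and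
    collapse by [casimirB_trace]. *)
Lemma proj1_casimirB g u :
  \sum_(p <- xy) B g p.1 * u * B g p.2 = proj1 u * one g.
Proof.
transitivity (\sum_(p <- xy) \sum_(q <- xy)
    B g p.1 * trace [set: G] (B g p.2 * q.1) * u * q.2).
  apply: eq_bigr => p _; rewrite -{1}[B g p.2](trace_dual WT) mulr_sumr.
  apply: eq_bigr => q _; rewrite mulrA; congr (_ * _).
  by rewrite -!mulrA (C_comm u (C_trace _)).
rewrite exchange_big /= -one_comm mulr_sumr; apply: eq_bigr => q _.
by rewrite -!mulr_suml casimirB_trace !mulrA.
Qed.

(** Compute [B g (proj1 u)] in two ways: as the image of a fixed element, and termwise through
    [proj1_casimirB]. *)
Lemma proj1_B g u : proj1 (B g u) = proj1 u * one g.
Proof.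
rewrite -[RHS](C_proj1 u (in_setT g)) -/(B g _) B_sum.
under eq_bigr => p _ do rewrite !BM.
by rewrite proj1_casimirB -proj1_Mc ?Bone //; apply: C_one.
Qed.

(** * Traces attain [1] *)

Lemma proj1_trace (H : {set G}) u :
  proj1 (trace H u) = proj1 u * \sum_(h in H) one h.
Proof. by rewrite proj1_sum mulr_sumr; apply: eq_bigr => h _; exact: proj1_B. Qed.

Lemma trace_sum H I (s : seq I) (P : pred I) F :
  trace H (\sum_(i <- s | P i) F i) = \sum_(i <- s | P i) trace H (F i).
Proof. by rewrite exchange_big; apply: eq_bigr => h _; exact: B_sum. Qed.

Lemma traceT_onto : exists w, trace [set: G] w = 1.
Proof.
(* Each [proj1 p.2] is central and leaves the trace, each trace is central and enters [proj1]; what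
   remains is [proj1] of the dual expansion of [1]. *)
exists (\sum_(p <- xy) p.1 * proj1 p.2); rewrite trace_sum -[RHS]proj1_1.
rewrite -[in RHS](trace_dual WT 1) proj1_sum; apply: eq_bigr => p _.
by rewrite trace_Mr ?proj1_cM ?mul1r //; [exact: C_trace | exact: C_proj1].
Qed.

(* [w] is the sum of [B c u] over representatives [c] of the cosets [H c]. *)
Lemma trace_coset H u : is_wide mul inv H ->
  exists w, trace [set: G] u = trace H w.
Proof.
move=> HW; pose eqv k g := (d k == d g) && (mul g (inv k) \in H).
have eqv_refl g : eqv g g by rewrite /eqv eqxx; apply: (wide_unit HW (unit_r HG g)).
have eqv_sym k g : eqv k g -> eqv g k.
  move=> /andP[/eqP dk kH]; rewrite /eqv dk eqxx.
  have := wide_inv HW kH; rewrite (inv_mul HG) ?(r_inv HG) //.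
  by rewrite (gpd_invK HG).
have eqv_trans k g h : eqv k g -> eqv g h -> eqv k h.
  move=> /andP[/eqP dk kH] /andP[/eqP dg gH]; rewrite /eqv dk dg eqxx /=.
  have hg : d (mul h (inv g)) = r g by rewrite (d_mul HG) ?(r_inv HG) ?(d_inv HG).
  have gk : d g = r (inv k) by rewrite (r_inv HG).
  have := wide_mul HW gH kH; rewrite hg (r_mul HG gk) => /(_ erefl).
  by rewrite -(gpd_mulA HG hg gk) (gpd_mulgVK HG).
(* The default [g] is never reached, since [eqv] is reflexive. *)
pose rep g := odflt g [pick k | eqv k g].
have repP g : eqv (rep g) g.
  by rewrite /rep; case: pickP => //= /(_ g); rewrite eqv_refl.
(* Equivalent elements have the same class predicate, and [pick] depends only on the predicate. *)
have rep_eq k g : eqv k g -> rep g = rep k.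
  move=> kg; rewrite /rep (@eq_pick _ _ (eqv^~ k)) => [|h] /=.
    by case: pickP => //= /(_ k); rewrite eqv_refl.
  by apply/idP/idP => h1; apply: eqv_trans h1 _ => //; apply: eqv_sym.
exists (\sum_(c | rep c == c) B c u); rewrite trace_sum.
rewrite /trace (partition_big rep (fun c => rep c == c)) /=; last first.
  by move=> g _; rewrite -(rep_eq _ _ (repP g)).
apply: eq_bigr => c /eqP cc.
rewrite [RHS](bigID (fun h => d h == r c)) /= [X in _ + X]big1 ?addr0; last first.
  by move=> h /andP[_ hc]; rewrite B_comp0.
rewrite (reindex_onto (mul^~ c) (mul^~ (inv c))) /=; last first.
  move=> g /andP[_ /eqP gc]; apply: (gpd_mulgVK HG).
  by have := repP g; rewrite gc => /andP[/eqP].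
(* Right multiplication by [c] matches the [h] in [H] composable with [c] and the class represented
   by [c]. *)
have pE h : (rep (mul h c) == c) && (mul (mul h c) (inv c) == h) =
    (h \in H) && (d h == r c).
  apply/andP/andP => [[/eqP hc /eqP e]|[hH /eqP hc]].
    have := repP (mul h c); rewrite hc => /andP[/eqP dc]; rewrite e => hH; split=> //.
    by rewrite -e (d_mul HG) ?(d_inv HG) // (r_inv HG).
  rewrite (gpd_mulgK HG) // eqxx; split=> //; apply/eqP; rewrite -[RHS]cc.
  by apply: rep_eq; rewrite /eqv (d_mul HG) // eqxx (gpd_mulgK HG).
by apply: eq_big => h; rewrite in_setT pE // => /andP[_ /eqP hc]; rewrite B_comp.
Qed.

Lemma trace_onto H : is_wide mul inv H -> exists w, trace H w = 1.
Proof.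
have [u u1] := traceT_onto => /(trace_coset u)[w]; rewrite u1 => w1.
by exists w.
Qed.

(** Apply [proj1] to an equation [trace H w = 1]. *)
Lemma inv_card_one H : is_wide mul inv H ->
  exists2 v, C v & v * \sum_(h in H) one h = 1.
Proof.
move=> /trace_onto[w w1]; exists (proj1 w); first exact: C_proj1.
by rewrite -proj1_trace w1 proj1_1.
Qed.

(** * Two-sided multiplications and invertibility of the [J g] *)

Lemma B_inner g u : B g u = \sum_(p <- xy) \sum_(q <- xy)
  B g p.1 * (\sum_(h : G) one h) * q.1 * p.2 * u * q.2.
Proof.
have Nc x : (\sum_(h : G) one h) * x = x * \sum_(h : G) one h.
  by rewrite mulr_suml mulr_sumr; apply: eq_bigr => h _; exact: one_comm.
rewrite -{1}[u](trace_dualr WT) B_sum; apply: eq_bigr => p _.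
rewrite (fixringMr _ (C_trace _)) ?inE //.
(* The trace is central and [proj1 1 = 1], so it equals its own [proj1], which [proj1_trace]
   computes. *)
have -> : trace [set: G] (p.2 * u) = proj1 (p.2 * u) * \sum_(h : G) one h.
  rewrite -[LHS]mulr1 -[1]proj1_1 -proj1_cM ?mulr1; last exact: C_trace.
  by rewrite proj1_trace; congr (_ * _); apply: eq_bigl => h; rewrite inE.
rewrite -Nc mulrA mulr_sumr; apply: eq_bigr => q _.
by rewrite !mulrA.
Qed.

Lemma proj_J g u : J g (proj g u).
Proof. by apply: (proj_Jg WT (in_setT g)); apply: centralizer_C. Qed.

(** The component of [a] in [J h] contributes to [a * x] a term in [J (mul g h)], and this index is
    an identity only for [h = inv g]. *)
Lemma proj1_proj g a x : J g x -> proj1 (a * x) = proj (inv g) a * x.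
Proof.
move=> Jx; rewrite -{1}[a](sum_proj WT (@centralizer_C a)) mulr_suml proj1_sum.
have Jp h := proj_J h a.
have dg : d g = r (inv g) by rewrite (r_inv HG).
rewrite (bigD1 (inv g)) ?inE //= (proj1_id (Jg_mul dg (Jp _) Jx)) -/(gr mul inv g).
rewrite (unit_r HG) big1 ?addr0 // => h /andP[_ hg].
case: (eqVneq (d g) (r h)) => [gh|gh]; last by rewrite (Jg_mul0 gh (Jp h) Jx) proj1_0.
rewrite (proj1_id (Jg_mul gh (Jp h) Jx)) -{1}[g](gpd_invK HG) (mulV_unit HG).
  by rewrite eq_sym (negPf hg).
by rewrite (r_inv HG).
Qed.

(* Writing [B g u = \sum a * u * b], one has [\sum a * proj g b = one g]; applying
   [proj1] then moves [a] into [J (inv g)]. *)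
Lemma Jg_invertible g : exists s : seq (R * R),
  (forall p, p \in s -> J (inv g) p.1 /\ J g p.2) /\
  \sum_(p <- s) p.1 * p.2 = one g.
Proof.
pose a (p q : R * R) := B g p.1 * (\sum_(h : G) one h) * q.1 * p.2.
exists [seq (proj (inv g) (a p q), proj g q.2) | p <- xy, q <- xy]; split.
  by move=> _ /allpairsP[[p q] [_ _ ->]]; split; apply: proj_J.
rewrite big_allpairs_dep /=.
have <- : proj1 (one g) = one g.
  by rewrite -[X in proj1 X]mul1r proj1_Mc ?proj1_1 ?mul1r //; apply: C_one.
(* Once each [B g t.1] is expanded by [B_inner], the sum over [t] assembles [proj g q.2]. *)
have -> : one g = \sum_(t <- xy) B g t.1 * B g t.2 by rewrite casimirB eqxx.
under [X in proj1 X]eq_bigr => t _ do rewrite B_inner mulr_suml.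
rewrite [in RHS]exchange_big proj1_sum; apply: eq_bigr => p _ /=.
under [X in proj1 X]eq_bigr => t _ do rewrite mulr_suml.
rewrite [in RHS]exchange_big proj1_sum; apply: eq_bigr => q _ /=.
rewrite -(proj1_proj _ (proj_J g _)) mulr_sumr; congr proj1; apply: eq_bigr => t _.
by rewrite !mulrA.
Qed.

(** * Double centralizers and separability *)

Lemma double_centralizer H x : is_wide mul inv H ->
  centralizer (centralizer (fix_ H)) x <-> fix_ H x.
Proof.
move=> HW; split=> [xV h hH|xH u uV]; last by rewrite uV.
(* For each factor [b] in [J h], [b * B h x = x * b = b * x], since [b] centralizes [fix_ H]; the
   sum then replaces [B h x] by [x * one h]. *)
have [s [sJ s1]] := Jg_invertible h.
rewrite -/(B h x) -oneB -one_comm -s1 !mulr_suml big_seq_cond [RHS]big_seq_cond.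
apply: eq_bigr => p /andP[/sJ[_ Jp] _]; rewrite -!mulrA (JgB _ Jp) xV // => y yH.
exact: Jg_fixring hH Jp yH.
Qed.

Lemma centralizer_subalg (S : R -> Prop) : is_subalgebra (centralizer S).
Proof.
split=> [|x y Vx Vy|x y Vx Vy|k x Vx] s sS.
- by rewrite mul1r mulr1.
- by rewrite mulrBl mulrBr Vx ?Vy.
- by rewrite -mulrA Vy // mulrA Vx // mulrA.
- by rewrite -scalerAl -scalerAr Vx.
Qed.

Lemma Jg_centralizer g (H : {set G}) x : g \in H -> J g x -> centralizer (fix_ H) x.
Proof. by move=> gH Jx s sH; apply: Jg_fixring gH Jx sH. Qed.

Lemma centralizer_separable H : is_wide mul inv H ->
  is_separable_over (centralizer (fix_ H)) C.
Proof.
move=> HW; set V := centralizer _.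
have [v vC v1] := inv_card_one HW.
have [s sP] := fin_all_exists Jg_invertible.
have sJ h p : p \in s h -> J (inv h) p.1 /\ J h p.2 by case: (sP h) => + _; apply.
have s1 h : \sum_(p <- s h) p.1 * p.2 = one h by case: (sP h).
have [V1 VB VM _] : is_subalgebra V := centralizer_subalg _.
have V0 : V 0 by rewrite -(subrr 1); apply: VB.
have VD x y : V x -> V y -> V (x + y).
  by move=> Vx Vy; rewrite -[y]opprK -[- y]add0r; apply/VB/VB/Vy/V0.
have VC x : C x -> V x by move=> xC u _; apply: C_comm.
have VJ g x : g \in H -> J g x -> V x := @Jg_centralizer g H x.
have Vs h p : h \in H -> p \in s h -> V (v * p.1) /\ V p.2.
  move=> hH /sJ[J1 J2]; split; last exact: VJ J2.
  exact: VM (VC _ vC) (VJ _ _ (wide_inv HW hH) J1).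
exists [seq (v * p.1, p.2) | h <- enum H, p <- s h]; split.
- move=> _ /allpairsPdep[h [p [hH pP ->]]]; apply: (Vs h) => //.
  by rewrite mem_enum in hH.
- rewrite big_allpairs_dep big_enum /= -v1 mulr_sumr; apply: eq_bigr => h _.
  by rewrite -s1 mulr_sumr; apply: eq_bigr => p _; rewrite mulrA.
move=> t tV M f [fDl fDr fC]; rewrite !big_allpairs_dep !big_enum /=.
have Vsum I (l : seq I) (P : pred I) F : (forall i, P i -> V (F i)) ->
    V (\sum_(i <- l | P i) F i) by move=> VF; apply: big_ind.
have f0l y : V y -> f 0 y = 0.
  by move=> Vy; apply: (addrI (f 0 y)); rewrite -fDl // !addr0.
have f0r x : V x -> f x 0 = 0.
  by move=> Vx; apply: (addrI (f x 0)); rewrite -fDr // !addr0.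
(* Additivity of [f] is available only on [V], hence the membership conditions. *)
have fl I (l : seq I) (P : pred I) F y : V y -> (forall i, P i -> V (F i)) ->
    f (\sum_(i <- l | P i) F i) y = \sum_(i <- l | P i) f (F i) y.
  move=> Vy VF; elim: l => [|i l IH]; first by rewrite !big_nil f0l.
  by rewrite !big_cons; case: ifP => // Pi; rewrite fDl ?IH //; [exact: VF | exact: Vsum].
have fr I (l : seq I) (P : pred I) F x : V x -> (forall i, P i -> V (F i)) ->
    f x (\sum_(i <- l | P i) F i) = \sum_(i <- l | P i) f x (F i).
  move=> Vx VF; elim: l => [|i l IH]; first by rewrite !big_nil f0r.
  by rewrite !big_cons; case: ifP => // Pi; rewrite fDr ?IH //; [exact: VF | exact: Vsum].
have tJ g : g \in H -> J g (proj g t) by move=> _; apply: proj_J.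
have Vt g : g \in H -> V (proj g t) by move=> gH; apply: VJ (tJ g gH).
(* Both sides are additive in [t], so it suffices to treat its components in the [J g]. *)
rewrite -(sum_proj HW tV).
transitivity (\sum_(g in H) \sum_(h in H) \sum_(p <- s h) f (proj g t * (v * p.1)) p.2).
  rewrite [RHS]exchange_big; apply: eq_bigr => h hH /=.
  rewrite [RHS]exchange_big big_seq [RHS]big_seq; apply: eq_bigr => p ps /=.
  have [V1p V2p] := Vs h p hH ps.
  by rewrite mulr_suml fl // => g gH; apply: VM V1p; apply: Vt.
transitivity (\sum_(g in H) \sum_(h in H) \sum_(p <- s h) f (v * p.1) (p.2 * proj g t));
    last first.
  rewrite exchange_big; apply: eq_bigr => h hH /=.
  rewrite exchange_big big_seq [RHS]big_seq; apply: eq_bigr => p ps /=.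
  have [V1p V2p] := Vs h p hH ps.
  by rewrite mulr_sumr fr // => g gH; apply: VM V2p _; apply: Vt.
apply: eq_bigr => g gH; have := tJ g gH; move: (proj g t) => {tJ Vt t tV} t tJ.
have tV := VJ _ _ gH tJ.
(* By [Jg_mul0] only [r h = r g] survives on the left and only [r h = d g] on the right; translation
   by [g] matches the two index sets. *)
rewrite (bigID (fun h => r h == r g)) /= [X in _ + X]big1 ?addr0; last first.
  move=> h /andP[hH hg]; rewrite big_seq big1 // => p ps.
  have [J1 _] := sJ h p ps; have [_ V2p] := Vs h p hH ps.
  rewrite mulrA -(C_comm t vC) -mulrA (Jg_mul0 _ tJ J1) ?mulr0 ?f0l //.
  by rewrite (d_inv HG).
rewrite [RHS](bigID (fun h => r h == d g)) /= [X in _ + X]big1 ?addr0; last first.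
  move=> h /andP[hH hg]; rewrite big_seq big1 // => p ps.
  have [_ J2] := sJ h p ps; have [V1p _] := Vs h p hH ps.
  by rewrite (Jg_mul0 _ J2 tJ) ?f0r // eq_sym.
rewrite (sum_translate HW) //; apply: eq_bigr => k /andP[kH /eqP kg].
have hH : mul g k \in H := wide_mul HW gH kH (esym kg).
(* Inserting [one k], the sum of the [q.1 * q.2], before [t * p.1] creates [q.2 * t * p.1]. It lies
   in [J] at an identity, so it is central and crosses the tensor sign. *)
transitivity (\sum_(p <- s (mul g k)) \sum_(q <- s k) f (v * q.1) (q.2 * t * (p.1 * p.2))).
  rewrite big_seq [RHS]big_seq; apply: eq_bigr => p ps.
  have [J1 J2] := sJ _ p ps; have [V1p V2p] := Vs _ p hH ps.
  have cC q : q \in s k -> C (q.2 * t * p.1).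
    move=> qs; have [_ Jq] := sJ k q qs.
    apply: (@Jg_C (d (mul g k))); first exact: (unit_d HG).
    by apply: Jg_mul J1; [rewrite (d_inv HG) | apply: Jg_mul].
  have Jtp : J (inv k) (t * p.1).
    rewrite -(@gpd_mulgVK _ _ _ HG (inv k) g) ?(d_inv HG) // -(inv_mul HG) //.
    by apply: Jg_mul => //; rewrite (d_inv HG) (r_mul HG).
  have -> : t * (v * p.1) = \sum_(q <- s k | q \in s k) v * q.1 * (q.2 * t * p.1).
    rewrite mulrA -(C_comm t vC) -mulrA -(Jg_oneV Jtp) (gpd_invK HG) -s1.
    rewrite mulr_suml mulr_sumr [LHS]big_seq.
    by apply: eq_bigr => q _; rewrite !mulrA.
  rewrite fl // => [|q qs]; last by apply: VM (VC _ (cC q qs)); case: (Vs k q kH qs).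
  rewrite [RHS]big_seq; apply: eq_bigr => q qs.
  by rewrite fC ?mulrA //; [case: (Vs k q kH qs) | exact: cC].
rewrite exchange_big big_seq [RHS]big_seq; apply: eq_bigr => q qs /=.
have [V1q V2q] := Vs k q kH qs.
rewrite big_seq -fr // => [|p ps]; last first.
  have [J1 J2] := sJ _ p ps.
  apply: (VM _ _ (VM _ _ V2q tV)).
  exact: VM (VJ _ _ (wide_inv HW hH) J1) (VJ _ _ hH J2).
(* The products [p.1 * p.2] sum to [one (mul g k)], which equals [one g] and is absorbed by [t]. *)
rewrite -big_seq -mulr_sumr s1 -mulrA (one_eq (h := g)) ?(r_mul HG) //.
by case: tJ => Et _; rewrite one1r.
Qed.

(** * Stabilizers and the Galois correspondence *)

Lemma HT_wide S : is_wide mul inv (HT inv one beta S).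
Proof.
have inHT g : reflect (forall t, S t -> B g t = t * one g) (g \in HT inv one beta S).
  by rewrite inE; apply: pboolP.
have unitsHT e : e \in units -> e \in HT inv one beta S.
  by move=> eu; apply/inHT => t _; apply: B_unit.
split; last exact/subsetP.
split.
- have /card_gt0P[g _] := gpd_nonempty HG.
  by apply/set0Pn; exists (r g); apply/unitsHT/unit_r.
- move=> g /inHT gS; apply/inHT => t St.
  have := B_one1 (inv g) t; rewrite (gpd_invK HG) => <-.
  rewrite -(gS t St) B_comp ?(d_inv HG) //.
  by rewrite -/(gd mul inv g) B_unit ?(unit_d HG) // one_d.
- move=> g h /inHT gS /inHT hS gh; apply/inHT => t St.
  rewrite -B_comp // hS // -one_r -gh one_d B_one1 gS //.
  by rewrite (one_eq (h := mul g h)) // (r_mul HG).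
Qed.

(** If [S] is the fixed ring of [H], then [H] lies in the stabilizer of [S], so anything fixed by
    the stabilizer is fixed by [H]. *)
Lemma fixring_HT S : satisfies_FT mul inv one beta -> is_subalgebra S ->
  (forall x, C x -> S x) -> is_separable_over S C ->
  fix_ (HT inv one beta S) = S.
Proof.
move=> [_ FT] Salg CS Ssep; apply: pred_ext => x; have [H HW SH] := FT S Salg CS Ssep.
split=> [xS|Sx h]; last by rewrite inE => /pboolP; apply.
apply/SH => h hH; apply: xS; rewrite inE; apply/pboolP => t /SH; apply.
exact: hH.
Qed.

End Galois.

Theorem theorem4p1 (K : comPzRingType) (R : algType K) (G : finType)
    (mul : G -> G -> G) (inv : G -> G) (E : G -> R -> Prop)
    (one : G -> R) (beta : G -> R -> R)
    (HG : is_groupoid mul inv)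
    (Hact : is_unital_action mul inv E one beta)
    (Hsum : is_direct_sum (gunits mul inv) E (fun _ => True))
    (Hgal : is_galois_ext mul inv one beta)
    (Hcentral : forall x, fixring inv one beta [set: G] x <-> center_of x)
    (HFT : satisfies_FT mul inv one beta) :
  forall S : R -> Prop, is_subalgebra S ->
    (forall x, fixring inv one beta [set: G] x -> S x) ->
    is_separable_over S (fixring inv one beta [set: G]) ->
    is_direct_sum (HT inv one beta S) (Jg inv E one beta) (centralizer S) /\
    is_direct_sum (HT inv one beta (centralizer S)) (Jg inv E one beta) S.
Proof.
move=> S Salg CS Ssep; have [xy Hxy] := Hgal.
have HS := fixring_HT HFT Salg CS Ssep.
have WS := HT_wide HG Hact S.
split; first by have := centralizer_fixring HG Hact Hsum Hxy WS; rewrite HS.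
have VSsep := centralizer_separable HG Hact Hsum Hxy Hcentral WS.
rewrite HS in VSsep.
have CVS x : fixring inv one beta [set: G] x -> centralizer S x.
  by move=> /Hcentral xC s _; apply: xC.
have HVS := fixring_HT HFT (centralizer_subalg S) CVS VSsep.
(* [S] is itself a fixed ring by [HS], so it is its own double centralizer. *)
have VVS : centralizer (centralizer S) = S.
  apply: pred_ext => x; rewrite -HS.
  exact: (double_centralizer HG Hact Hsum Hxy Hcentral).
have := centralizer_fixring HG Hact Hsum Hxy (HT_wide HG Hact (centralizer S)).
by rewrite HVS VVS.
Qed.
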